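(* A perfect cuboid exists if and only if there exist rational numbers $\alpha_2,\beta_2,\gamma_2\in\mathbb{Q}\setminus\{0,1,-1\}$ satisfying $$\Big(\frac{2\gamma_2}{1-\gamma_2^2}\Big)^2+\Big(\frac{2\beta_2}{1-\beta_2^2}\Big)^2=\Big(\frac{2\alpha_2}{1-\alpha_2^2}\Big)^2.$$
   Context: A perfect cuboid is a triple of positive rational numbers $a,b,c$ such that $a^2+b^2$, $b^2+c^2$, $a^2+c^2$ and $a^2+b^2+c^2$ are all squares of rational numbers. *)

(* Defs.v *)
From mathcomp Require Import all_boot all_order all_algebra.

Set Implicit Arguments.
Unset Strict Implicit.
Unset Printing Implicit Defensive.

Import Order.TTheory GRing.Theory Num.Theory.
Local Open Scope ring_scope.

Definition is_rat_square (x : rat) : Prop := exists r : rat, x = r ^+ 2.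

Definition perfect_cuboid (a b c : rat) : Prop :=
  [/\ 0 < a, 0 < b & 0 < c] /\
  [/\ is_rat_square (a ^+ 2 + b ^+ 2),
      is_rat_square (b ^+ 2 + c ^+ 2),
      is_rat_square (a ^+ 2 + c ^+ 2) &
      is_rat_square (a ^+ 2 + b ^+ 2 + c ^+ 2)].

(* Main.v *)
Require Import Defs.
From mathcomp Require Import all_boot all_order all_algebra.
From mathcomp Require Import ring.

Set Implicit Arguments.
Unset Strict Implicit.
Unset Printing Implicit Defensive.

Import Order.TTheory GRing.Theory Num.Theory.
Local Open Scope ring_scope.

(** Scale a cuboid so that c = 1.  The face and space diagonal conditions then
    say that x = a, y = b and z = sqrt (a^2 + b^2) satisfy x^2 + y^2 = z^2 and
    that 1 + x^2, 1 + y^2, 1 + z^2 are squares.  For x != 0, the number 1 + x^2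
    is a square exactly when x = 2t / (1 - t^2) for some t outside {0, 1, -1}
    (projecting the hyperbola r^2 - x^2 = 1 from one of its points). *)

Section TangentDoubling.
Variable F : numFieldType.
Implicit Types t x r : F.

Definition tan2 t : F := 2%:R * t / (1 - t ^+ 2).

Lemma notin_01N1 t :
  (t \notin [:: 0; 1; -1]) = (t != 0) && (1 - t ^+ 2 != 0).
Proof.
rewrite !inE !negb_or; congr (_ && _).
by rewrite -negb_or -eqf_sqr expr1n subr_eq0 [1 == _]eq_sym.
Qed.

Lemma tan2_neq0 t : t \notin [:: 0; 1; -1] -> tan2 t != 0.
Proof.
rewrite notin_01N1 => /andP[t0 d0].
by rewrite /tan2 !mulf_neq0 ?invr_eq0 ?pnatr_eq0.
Qed.

(** This is the Pythagorean identity [(1 - t^2)^2 + (2t)^2 = (1 + t^2)^2] divided by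
    [(1 - t^2)^2]. *)
Lemma one_add_tan2_sqr t : t \notin [:: 0; 1; -1] ->
  1 + tan2 t ^+ 2 = ((1 + t ^+ 2) / (1 - t ^+ 2)) ^+ 2.
Proof. by rewrite notin_01N1 => /andP[_ d0]; rewrite /tan2; field. Qed.

Lemma tan2_surj x r : x != 0 -> 1 + x ^+ 2 = r ^+ 2 ->
  exists2 t, t \notin [:: 0; 1; -1] & tan2 t = x.
Proof.
move=> x0 hr.
have x2E : x ^+ 2 = (r - 1) * (r + 1).
  by rewrite -[x ^+ 2](addKr 1) hr; ring.
have [r1 _] : r - 1 != 0 /\ r + 1 != 0.
  by apply/andP; rewrite -negb_or -mulf_eq0 -x2E sqrf_eq0.
have n0 : 2%:R * (r - 1) != 0 by rewrite mulf_neq0 ?pnatr_eq0.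
(* The parameter [(r - 1) / x] is the slope of the line from [(0, 1)] to [(x, r)] on the hyperbola;
   the value found here is nonzero, which excludes the asymptotic slopes 1 and -1. *)
have dE : 1 - ((r - 1) / x) ^+ 2 = 2%:R * (r - 1) / x ^+ 2.
  have -> : 2%:R * (r - 1) = x ^+ 2 - (r - 1) ^+ 2 by rewrite x2E; ring.
  by field.
exists ((r - 1) / x); last by rewrite /tan2 dE; field; rewrite x0 r1.
by rewrite notin_01N1 dE !mulf_eq0 !invr_eq0 sqrf_eq0 pnatr_eq0 (negPf r1) (negPf x0).
Qed.

Lemma tan2_surj_ratio x y r : y != 0 -> x != 0 -> x ^+ 2 + y ^+ 2 = r ^+ 2 ->
  exists2 t, t \notin [:: 0; 1; -1] & tan2 t = x / y.
Proof.
move=> y0 x0 hr; apply: (@tan2_surj _ (r / y)).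
  by rewrite mulf_neq0 ?invr_eq0.
by rewrite [RHS]expr_div_n -hr; field.
Qed.

End TangentDoubling.

Theorem theorem2 :
  (exists a b c : rat, perfect_cuboid a b c) <->
  (exists alpha2 beta2 gamma2 : rat,
     [/\ alpha2 \notin [:: 0; 1; -1],
         beta2 \notin [:: 0; 1; -1],
         gamma2 \notin [:: 0; 1; -1] &
         (2%:R * gamma2 / (1 - gamma2 ^+ 2)) ^+ 2 +
         (2%:R * beta2 / (1 - beta2 ^+ 2)) ^+ 2 =
         (2%:R * alpha2 / (1 - alpha2 ^+ 2)) ^+ 2]).
Proof.
split=> [[a [b [c [[a0 b0 c0] [[p hp] [q hq] [s hs] [d hd]]]]]]|].
  have an0 : a != 0 by rewrite gt_eqF.
  have bn0 : b != 0 by rewrite gt_eqF.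
  have cn0 : c != 0 by rewrite gt_eqF.
  have pn0 : p != 0 by rewrite -sqrf_eq0 -hp gt_eqF // addr_gt0 ?exprn_gt0.
  (* Now [p ^+ 2 + c ^+ 2 = d ^+ 2]: the face diagonal [p] is a leg over [c], just like [a] and
     [b]. *)
  rewrite hp in hd.
  have [alpha ? Ea] := tan2_surj_ratio cn0 pn0 hd.
  have [beta ? Eb] := tan2_surj_ratio cn0 bn0 hq.
  have [gamma ? Ec] := tan2_surj_ratio cn0 an0 hs.
  exists alpha, beta, gamma; split=> //.
  rewrite -!/(tan2 _) Ea Eb Ec !expr_div_n -hp.
  by rewrite mulrDl.
move=> [alpha [beta [gamma [ha hb hc]]]]; rewrite -!/(tan2 _) => E.
(* [tan2] may be negative, while edges must be positive; only squares matter afterwards. *)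
exists `|tan2 gamma|, `|tan2 beta|, 1.
split; first by rewrite !normr_gt0 !tan2_neq0.
(* [E] acts on both the face and the space diagonal, turning the latter into
   [tan2 alpha ^+ 2 + 1]. *)
rewrite !real_normK ?num_real // E expr1n.
split; first by exists (tan2 alpha).
- by rewrite addrC one_add_tan2_sqr //; eexists.
- by rewrite addrC one_add_tan2_sqr //; eexists.
- by rewrite addrC one_add_tan2_sqr //; eexists.
Qed.
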